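(* For any $n\ge 2$ there is a sequence $(\Lambda_k)$ of number field lattices in $\mathcal{L}_n$ for which $\kappa(\Lambda_k)\nearrow 1$ (the sequence $\kappa(\Lambda_k)$ is increasing and converges to $1$). In particular, $1$ is not an isolated point of $\widehat{\mathbf{MG}}_n$.
   Context: $G=\mathrm{SL}_n(\mathbb{R})$, $A\subset G$ is the subgroup of diagonal matrices with positive diagonal entries, and $\mathcal{L}_n\cong G/\mathrm{SL}_n(\mathbb{Z})$ is the space of lattices in $\mathbb{R}^n$ of covolume $1$. Mordell constant: a symmetric box is a set $[-a_1,a_1]\times\cdots\times[-a_n,a_n]$ with $a_i>0$; it is admissible for a lattice $\Lambda\subset\mathbb{R}^n$ if its interior contains no nonzero point of $\Lambda$. Then $\kappa(\Lambda)=\sup_{\mathcal{B}}\frac{\mathrm{Vol}(\mathcal{B})}{2^n\mathrm{Vol}(\Lambda)}$, the supremum over symmetric boxes $\mathcal{B}$ admissible for $\Lambda$, where $\mathrm{Vol}(\Lambda)$ is the covolume. A number field lattice is a lattice $\Lambda\in\mathcal{L}_n$ for which $A\Lambda$ is closed and of finite volume (equivalently, compact). A lattice $\Lambda\subset\mathbb{R}^n$ is decomposable if there are $n_1,n_2>0$ with $n=n_1+n_2$ and a partition of the coordinates into subsets of sizes $n_1,n_2$, with corresponding direct sum decomposition $\mathbb{R}^n=\mathbb{R}^{n_1}\oplus\mathbb{R}^{n_2}$, such that $\Lambda=\Lambda_1\oplus\Lambda_2$ where $\Lambda_i=\Lambda\cap\mathbb{R}^{n_i}$. The reduced Mordell-Gruber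 spectrum is $\widehat{\mathbf{MG}}_n=\{\kappa(\Lambda):\Lambda\subset\mathbb{R}^n\text{ a lattice which is not decomposable}\}\subset\mathbb{R}$. *)

(* Defs.v *)
From HB Require Import structures.
From mathcomp Require Import all_boot all_order all_algebra.
From mathcomp Require Import generic_quotient.
From mathcomp Require Import all_classical all_reals all_analysis.

Set Implicit Arguments.
Unset Strict Implicit.
Unset Printing Implicit Defensive.

Import Order.TTheory GRing.Theory Num.Theory.
Import numFieldNormedType.Exports.

Local Open Scope classical_set_scope.
Local Open Scope ring_scope.
Local Open Scope quotient_scope.

Definition int_mx (R : pzRingType) (m n : nat) (z : 'M[int]_(m, n)) :
  'M[R]_(m, n) := map_mx intr z.
Arguments int_mx R {m n} z.

Section Lattices.
Variables (R : realType) (n : nat).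
Implicit Types (B : 'M[R]_n) (Lambda : set 'cV[R]_n).

(* Vectors of R^n are columns; the columns of B are the basis vectors. *)
Definition lattice_of B : set 'cV[R]_n := [set B *m int_mx R z | z in setT].

Definition is_basis Lambda B := B \in unitmx /\ Lambda = lattice_of B.

Definition is_lattice Lambda := exists B, is_basis Lambda B.

(* The value does not depend on the basis, see covolumeE. *)
Definition covolume Lambda : R :=
  xget 0 [set `|\det B| | B in is_basis Lambda].

Lemma lattice_of_eq B B' : lattice_of B = lattice_of B' ->
  exists z : 'M[int]_n, B' = B *m int_mx R z.
Proof.
move=> BB'; have inB j : exists z : 'cV[int]_n, B *m int_mx R z = col j B'.
  have : lattice_of B (col j B').
    rewrite BB'; exists (delta_mx j 0) => //.
    rewrite (_ : int_mx R _ = delta_mx j 0) ?colE//.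
    by apply/matrixP => i k; rewrite !mxE; case: (_ && _).
  by case=> z _ <-; exists z.
exists (\matrix_(i, j) projT1 (cid (inB j)) i 0).
apply/matrixP => i j; have := projT2 (cid (inB j)).
move/matrixP => /(_ i 0); rewrite !mxE => <-.
by apply: eq_bigr => k _; rewrite !mxE.
Qed.

Lemma covolumeE B : B \in unitmx -> covolume (lattice_of B) = `|\det B|.
Proof.
move=> uB; rewrite /covolume; case: xgetP => [_ -> [B' [uB' BB'] <-]|]; last first.
  by move=> /(_ `|\det B|) []; exists B.
have [z zE] := lattice_of_eq BB'; have [w wE] := lattice_of_eq (esym BB').
have le C C' (v : 'M[int]_n) : C \in unitmx -> C' = C *m int_mx R v ->
    C' \in unitmx -> `|\det C| <= `|\det C'|.
  move=> uC ->; rewrite unitmx_mul det_mulmx normrM => /andP[_ uv].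
  rewrite ler_peMr//; move: uv; rewrite unitmxE unitfE /int_mx det_map_mx.
  by rewrite intr_eq0 -intr_norm ler1z -gtz0_ge1 normr_gt0.
by apply/eqP; rewrite eq_le (le _ _ _ uB' wE uB) (le _ _ _ uB zE uB').
Qed.

Definition sym_box (a : 'I_n -> R) : set 'cV[R]_n :=
  [set x | forall i, - a i <= x i 0 <= a i].

Definition admissible Lambda (a : 'I_n -> R) :=
  forall x, Lambda x -> x != 0 -> ~ ((sym_box a)^°) x.

Definition box_volume (a : 'I_n -> R) : R := \prod_(i < n) (2 * a i).

(* For a lattice this set is nonempty and, by Minkowski's theorem, bounded by
   1, so that sup does not take its default value. *)
Definition kappa Lambda : R :=
  sup [set box_volume a / (2 ^+ n * covolume Lambda) |
        a in [set a | (forall i, 0 < a i) /\ admissible Lambda a]].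

Definition supported_on (I : {set 'I_n}) : set 'cV[R]_n :=
  [set x | forall i, i \notin I -> x i 0 = 0].

Definition decomposable Lambda := exists I : {set 'I_n},
  [/\ (0 < #|I|)%N, (0 < #|~: I|)%N &
      Lambda = [set x + y | x in Lambda `&` supported_on I &
                            y in Lambda `&` supported_on (~: I)]].

Definition reduced_MG : set R :=
  [set kappa Lambda | Lambda in [set L | is_lattice L /\ ~ decomposable L]].

(* SL_n(R) carries the subspace topology as a subtype of 'M[R]_n. *)
Definition SL : set 'M[R]_n := [set g | \det g = 1].

Definition same_coset (g h : SL) : bool :=
  `[< exists2 z : 'M[int]_n, \det z = 1 & \val h = \val g *m int_mx R z >].

Lemma same_coset_refl : reflexive same_coset.
Proof.
move=> g; apply/asboolP; exists 1%:M; first by rewrite det1.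
by rewrite /int_mx map_mx1 mulmx1.
Qed.

Lemma same_coset_sym : symmetric same_coset.
Proof.
suff H g h : same_coset g h -> same_coset h g.
  by move=> g h; apply/idP/idP; exact: H.
move=> /asboolP[z z1 hE]; apply/asboolP; exists (\adj z).
  by have := congr1 determinant (mul_mx_adj z);
     rewrite det_mulmx z1 mul1r det1.
by rewrite hE -mulmxA -map_mxM mul_mx_adj z1 /int_mx map_mx1 mulmx1.
Qed.

Lemma same_coset_trans : transitive same_coset.
Proof.
move=> h g k /asboolP[z z1 hE] /asboolP[w w1 kE]; apply/asboolP.
exists (z *m w); first by rewrite det_mulmx z1 w1 mulr1.
by rewrite /int_mx map_mxM mulmxA -hE.
Qed.

Canonical same_coset_equiv :=
  EquivRel same_coset same_coset_refl same_coset_sym same_coset_trans.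

(* G / SL_n(Z) with the quotient topology. *)
Definition lattice_space : topologicalType :=
  quotient_topology {eq_quot same_coset_equiv}.

(* The coset g SL_n(Z) is the lattice g Z^n, see lattice_pi. *)
Definition lattice (L : lattice_space) : set 'cV[R]_n :=
  lattice_of (\val (repr (L : {eq_quot same_coset_equiv}))).

Lemma lattice_pi (g : SL) :
  lattice (\pi_{eq_quot same_coset_equiv} g) = lattice_of (\val g).
Proof.
have H h k : same_coset h k -> lattice_of (\val k) `<=` lattice_of (\val h).
  move=> /asboolP[z _ ->] _ [v _ <-]; exists (z *m v) => //.
  by rewrite /int_mx map_mxM mulmxA.
have gg : same_coset g (repr (\pi_{eq_quot same_coset_equiv} g)).
  by rewrite -[same_coset _ _]/(same_coset_equiv _ _) -eqmodE reprK.
by rewrite eqEsubset; split; apply: H => //; rewrite same_coset_sym.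
Qed.

Definition diag_group : set 'M[R]_n :=
  [set a | [/\ is_diag_mx a, forall i, 0 < a i i & \det a = 1]].

Definition diag_orbit (L : lattice_space) : set lattice_space :=
  [set M | exists2 a, diag_group a &
           lattice M = [set a *m x | x in lattice L]].

(* An A-orbit is closed and of finite volume if and only if it is compact;
   the latter is the form used as the definition. *)
Definition number_field_lattice (L : lattice_space) := compact (diag_orbit L).

End Lattices.

Arguments reduced_MG R n : clear implicits.
Arguments SL R n : clear implicits.

(* Main.v *)
(* Choose integers a_1, .., a_n far apart and let theta_i be the root near a_i
   of prod_k (X - a_k) = 1. All theta - a_k are then units of Z[theta], and the
   Newton basis of Z[theta], rescaled by a diagonal matrix, is close to the
   identity. Such a lattice has kappa close to 1, because slightly shrunk unit
   cubes are admissible. The logarithms of the units span the hyperplane of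
   sum-zero vectors, so the stabilizer of the lattice is cocompact in A and the
   A-orbit is compact. Cocompactness also forbids nonzero lattice vectors with
   a vanishing coordinate.

   Strictness kappa < 1: by cocompactness the supremum is attained, so if it
   were at least 1, then some lattice in the A-orbit would tile space by unit
   cubes. By Keller's argument each nonzero vector of that lattice has an
   integer coordinate, which forces a rational relation in some row of the
   basis, hence a nonzero vector with a vanishing coordinate. *)
Require Import Defs.
From mathcomp Require Import all_boot all_order all_algebra.
From mathcomp Require Import all_classical all_reals all_analysis.
From mathcomp Require Import ring lra zify.
Set Implicit Arguments.
Unset Strict Implicit.
Unset Printing Implicit Defensive.
Import Order.TTheory GRing.Theory Num.Theory.
Import numFieldNormedType.Exports.
Local Open Scope classical_set_scope.
Local Open Scope ring_scope.

(** * Keller's theorem on cube tilings *)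

Section CubeTilings.
Variables (R : realType) (n : nat) (I : Type).
Implicit Types (x : I -> 'I_n -> R) (p q : 'I_n -> R) (a b : I).

Definition upd p i (c : R) : 'I_n -> R := fun j => if j == i then c else p j.
Arguments upd p i c j /.

Definition in_cube (c p : 'I_n -> R) := forall i, c i <= p i < c i + 1.

Definition cube_tiling x :=
  (forall p, exists a, in_cube (x a) p) /\
  (forall p a b, in_cube (x a) p -> in_cube (x b) p -> a = b).

(** The cube [b] holding the point over [p] on the upper face of [a] must start there: were it
    lower, [a] and [b] would share a point of that line. *)
Lemma cube_above x a p i : cube_tiling x -> in_cube (x a) p ->
  exists b, in_cube (x b) (upd p i (x a i + 1)) /\
            x b i = x a i + 1.
Proof.
move=> [cov pack] ap; have [b bq] := cov (upd p i (x a i + 1)).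
exists b; split=> //; have := bq i; rewrite /= eqxx => /andP[ble blt].
apply/eqP; rewrite eq_le ble /= leNgt; apply/negP => lt_b.
have r_max c : x a i <= c < x a i + 1 -> x b i <= c < x b i + 1 -> False.
  move=> ac bc; have E : a = b.
    apply: (pack (upd p i (c))) => j /=; case: eqP => [->|/eqP ji]//.
    by have := bq j; rewrite /= (negbTE ji).
  by move: blt; rewrite E ltxx.
by apply: (r_max (Num.max (x a i) (x b i))); rewrite le_max gt_max; lra.
Qed.

(** The two cubes meet a common line in direction [i]. Stacking cubes face to face along it from the
    lower one reaches the other after a whole number of steps. *)
Lemma cube_column x a b p q i : cube_tiling x ->
    in_cube (x a) p -> in_cube (x b) q -> (forall j, j != i -> p j = q j) ->
  x b i - x a i \is a Num.int.
Proof.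
move=> tx; wlog le_ab : a b p q / x a i <= x b i => [W ap bq pq|ap bq pq].
  have [/W|/ltW/W] := leP (x a i) (x b i); first exact.
  by move=> /(_ q p bq ap) W'; rewrite -opprB rpredN W'// => j /pq.
have up k : exists c pc, [/\ in_cube (x c) pc, x c i = x a i + k%:R &
    forall j, j != i -> pc j = p j].
  elim: k => [|k [c [pc [cpc cE pcE]]]].
    by exists a, p; rewrite addr0.
  have [d [dpc dE]] := cube_above i tx cpc.
  exists d, (upd pc i (x c i + 1)); split=> //.
    by rewrite dE cE -natr1 addrA.
  by move=> j ji /=; rewrite (negbTE ji) pcE.
have k0 : 0 <= x b i - x a i by rewrite subr_ge0.
have := truncn_itv k0; set k := Num.truncn _ => /andP[k1 k2].
have [c [pc [cpc cE pcE]]] := up k.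
have <- : c = b.
  apply: (tx.2 (upd q i (x b i))) => j /=; case: eqP => [->|/eqP ji].
  - by move: k2; rewrite -natr1; lra.
  - by rewrite -pq// -pcE.
  - by lra.
  - exact: bq.
by rewrite cE addrAC subrr add0r natr_int.
Qed.

Definition shift_class x i (t s : R) : I -> 'I_n -> R := fun a =>
  if `[< x a i - t \is a Num.int >] then (upd (x a) i (x a i + s))
  else x a.

Lemma in_cube_shift (c p : 'I_n -> R) i s :
  in_cube (upd c i (c i + s)) p <->
  in_cube c (upd p i (p i - s)).
Proof.
by split=> + j => /(_ j) /=; case: eqP => [->|]//; lra.
Qed.

(** By [cube_column], cubes meeting a common line in direction [i] are all in the class or all
    outside, so each such line is shifted as a whole or left fixed. *)
Lemma shift_class_tiling x i t s :
  cube_tiling x -> cube_tiling (shift_class x i t s).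
Proof.
move=> tx; have [cov pack] := tx.
have same a b p q : in_cube (x a) p -> in_cube (x b) q ->
    (forall j, j != i -> p j = q j) ->
    `[< x a i - t \is a Num.int >] = `[< x b i - t \is a Num.int >].
  move=> ap bq /(cube_column tx ap bq) ab; apply: asbool_equiv_eq; split=> h.
  - by rewrite -(subrK (x a i) (x b i)) -addrA rpredD.
  - by rewrite -(subKr (x b i) (x a i)) addrAC rpredB.
split=> [p|p a b].
  have [a ap] := cov p; have [b bp] := cov (upd p i (p i - s)).
  have ab := same _ _ _ _ ap bp.
  case at_ : `[< x a i - t \is a Num.int >]; last first.
    by exists a; rewrite /shift_class at_.
  exists b; rewrite /shift_class -ab ?at_; first exact/in_cube_shift.
  by move=> j ji /=; rewrite (negbTE ji).
have red c : in_cube (shift_class x i t s c) p -> exists q, [/\ in_cube (x c) q,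
    forall j, j != i -> q j = p j &
    q = if `[< x c i - t \is a Num.int >] then (upd p i (p i - s))
        else p].
  rewrite /shift_class; case: ifP => _ cp; last by exists p.
  exists (upd p i (p i - s)); split => //; first exact/in_cube_shift.
  by move=> j ji /=; rewrite (negbTE ji).
move=> /red[q [aq qp qE]] /red[r [br rp rE]].
have E : q = r by rewrite qE rE (same _ _ _ _ aq br)// => j ji; rewrite qp// rp.
by apply: (pack q) => //; rewrite E.
Qed.

(* Keller: shifting a whole class of cubes modulo 1 in one coordinate keeps
   the tiling, so two cubes without nonzero integer coordinate difference
   could be moved on top of each other. *)
Lemma cube_tiling_keller x a b : cube_tiling x ->
    (forall i, x b i - x a i \is a Num.int -> x b i = x a i) ->
  a = b.
Proof.
have [m] := ubnP #|[pred i | x b i != x a i]|.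
elim: m => // m IH in x *; rewrite ltnS => le_m tx xab.
have [ab|] := boolP [forall i, x b i == x a i].
  have {}ab i : x b i = x a i by apply/eqP/(forallP ab).
  by apply: (tx.2 (x a)) => i; rewrite ?ab; lra.
rewrite negb_forall => /existsP[i abi].
(* [b] is outside the class of [a] and stays put, while [a] acquires the [i]-th coordinate of [b]:
   one differing coordinate fewer. *)
set y := shift_class x i (x a i) (x b i - x a i).
have yb : y b = x b.
  rewrite /y /shift_class; case: asboolP => // /xab E.
  by rewrite E eqxx in abi.
have ya : y a = (upd (x a) i (x b i)).
  rewrite /y /shift_class; case: asboolP; last by rewrite subrr rpred0.
  by move=> _; apply/funext => j /=; case: eqP => // _; rewrite subrKC.
apply: (IH y); last 2 first.
- exact: shift_class_tiling.
- by move=> j; rewrite yb ya /=; case: (j =P i) => [->//|_]; exact: xab.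
apply: leq_trans le_m; apply: proper_card; apply/properP; split.
  apply/fintype.subsetP => j; rewrite !inE yb ya /=.
  by case: (j =P i) => [->|//]; rewrite eqxx.
by exists i; rewrite inE ?yb ?ya /= ?eqxx.
Qed.

End CubeTilings.

(** * Packing modulo a lattice *)

(** The index of M Z^n in Z^n is |det M|: after Smith normal form, the residues of [invmx L *m f t]
    modulo the invariant factors separate classes. *)
Lemma int_index_le n (M : 'M[int]_n) (T : finType) (f : T -> 'cV[int]_n) :
    \det M != 0 ->
    (forall s t z, f s - f t = M *m z -> s = t) ->
  (#|T| <= `|\det M|)%N.
Proof.
move=> dM fM; have [L uL [Q uQ [d _ ME]]] := int_Smith_normal_form M.
set D := \matrix_(i, j) _ in ME.
have absu (U : 'M[int]_n) : U \in unitmx -> `|\det U|%N = 1%N.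
  by rewrite unitmxE => /orP[] /eqP ->.
have detD : \det D = \prod_(i < n) d`_i.
  rewrite (_ : D = diag_mx (\row_(i < n) d`_i)) ?det_diag.
    by apply: eq_bigr => i _; rewrite mxE.
  by apply/matrixP => i j; rewrite !mxE.
have absM : `|\det M|%N = (\prod_(i < n) absz (d`_i)%R)%N.
  rewrite ME !det_mulmx !abszM (absu _ uL) (absu _ uQ) mul1n muln1 detD.
  by rewrite (big_morph absz abszM (erefl _)).
have d_neq0 (i : 'I_n) : d`_i != 0.
  move: dM; rewrite -absz_gt0 absM; apply: contraTN => /eqP di.
  by rewrite (bigD1 i)//= di.
have lt_d (i : 'I_n) (x : int) : (absz (x %% d`_i)%Z < absz (d`_i)%R)%N.
  by rewrite -ltz_nat gez0_abs ?modz_ge0// abszE ltz_mod.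
pose h t : {dffun forall i : 'I_n, 'I_(absz (d`_i)%R)} :=
  [ffun i => Ordinal (lt_d i ((invmx L *m f t) i 0))].
have inj_h : injective h.
  move=> s t hst; have [v vE] : exists v, v = invmx L *m (f s - f t) by eexists.
  have dv (i : 'I_n) : (d`_i %| v i 0%R)%Z.
    rewrite vE mulmxBr mxE [X in _ + X]mxE -eqz_mod_dvd.
    have /ffunP/(_ i)/(congr1 val) := hst; rewrite !ffunE /= => E.
    by apply/eqP; rewrite -[LHS]gez0_abs ?modz_ge0// E gez0_abs ?modz_ge0.
  pose w := \col_(i < n) ((v i 0)%R %/ d`_i)%Z.
  apply: (fM _ _ (invmx Q *m w)); rewrite ME -!mulmxA mulKVmx//.
  rewrite [D *m w](_ : _ = v); first by rewrite vE !mulKVmx.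
  apply/matrixP => i j; rewrite ord1 mxE (bigD1 i)//= big1 ?addr0 => [|k ki].
    by rewrite !mxE eqxx mulr1n mulrC divzK.
  by rewrite mxE val_eqE eq_sym (negbTE ki) mulr0n mul0r.
rewrite (leq_trans (leq_card h inj_h))//.
rewrite card_dep_ffun foldrE big_image absM /=.
by apply: leq_prod => i _; rewrite card_ord.
Qed.

(** * Coordinates of lattice points and their integer approximation *)

Section LatticePoints.
Variables (R : realType) (n : nat).
Implicit Types (g : 'M[R]_n) (z : 'cV[int]_n).

Definition coor g z i : R := (g *m int_mx R z) i 0.

Lemma coorE g z i : coor g z i = \sum_j g i j * (z j 0)%:~R.
Proof. by rewrite /coor mxE; apply: eq_bigr => j _; rewrite mxE. Qed.

Lemma coorB g z z' i : coor g (z - z') i = coor g z i - coor g z' i.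
Proof. by rewrite /coor /int_mx map_mxB mulmxBr !mxE. Qed.

Lemma coor_norm1_le g : g \in unitmx ->
  exists2 H : R, 0 <= H & forall z (c : R), (forall i, `|coor g z i| <= c) ->
  \sum_j `|(z j 0)%:~R| <= H * c.
Proof.
move=> ug; exists (\sum_j \sum_k `|invmx g j k|).
  by apply: sumr_ge0 => j _; apply: sumr_ge0.
move=> z c zc; rewrite mulr_suml; apply: ler_sum => j _.
have -> : (z j 0)%:~R = (invmx g *m (g *m int_mx R z)) j 0.
  by rewrite mulKmx// !mxE.
rewrite mxE (le_trans (ler_norm_sum _ _ _))// mulr_suml.
by apply: ler_sum => k _; rewrite normrM ler_wpM2l//; exact: zc.
Qed.

(** A bootstrap: the error is at most the l1-norm [S] of [z], which in turn is at most H (B + S/k).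
    For k >= 2H the term H S/k is absorbed into S/2. *)
Lemma coor_approx g (B : R) : g \in unitmx -> 0 <= B ->
  exists2 K : R, 0 <= K & forall (k : nat) (M : 'M[int]_n) z, K <= k%:R ->
    (forall i j, `|k%:R * g i j - (M i j)%:~R| <= 1) ->
    (forall i, `|((M *m z) i 0)%:~R| <= B * k%:R) ->
  forall i, `|k%:R * coor g z i - ((M *m z) i 0)%:~R| <= K.
Proof.
move=> ug B0; have [H H0 zH] := coor_norm1_le ug.
exists (2 * H * (B + 1) + 1); first by rewrite addr_ge0// !mulr_ge0 ?addr_ge0.
move=> k M z kK gM zB; set S := \sum_j `|(z j 0)%:~R| : R.
have S0 : 0 <= S by exact: sumr_ge0.
have k_gt0 : 0 < k%:R :> R.
  by apply: lt_le_trans kK; rewrite ltr_pwDr// !mulr_ge0 ?addr_ge0.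
have err i : `|k%:R * coor g z i - ((M *m z) i 0)%:~R| <= S.
  rewrite coorE mxE raddf_sum/= mulr_sumr -sumrB.
  rewrite (le_trans (ler_norm_sum _ _ _))//; apply: ler_sum => j _.
  by rewrite rmorphM/= mulrA -mulrBl normrM ler_piMl.
have : S <= H * (B + S / k%:R).
  apply: zH => i; have := err i; have := zB i.
  move=> h1 h2; rewrite -(ler_pM2l k_gt0) mulrDr (mulrCA k%:R S).
  rewrite divff ?gt_eqF// mulr1 (mulrC _ B).
  rewrite -{1}(gtr0_norm k_gt0) -normrM -[X in `|X|](subrK ((M *m z) i 0)%:~R).
  by rewrite (le_trans (ler_normD _ _))// addrC lerD.
have : H * (S / k%:R) <= S / 2.
  rewrite mulrCA ler_wpM2l// ler_pdivrMr// mulrC ler_pdivlMr//.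
  by move: kK; have := mulr_ge0 H0 B0; lra.
rewrite mulrDr => h1 h2 i; apply: (le_trans (err i)).
have := mulr_ge0 H0 B0; nra.
Qed.

End LatticePoints.

Section LatticeVolume.
Variables (R : realType) (n : nat).
Implicit Types (g : 'M[R]_n) (z : 'cV[int]_n).

Lemma cvg_det (F : nat -> 'M[R]_n) g :
    (forall i j, F k i j @[k --> \oo] --> g i j) ->
  \det (F k) @[k --> \oo] --> \det g.
Proof.
move=> Fg; rewrite /determinant; apply: cvg_big => [|s _]; first exact: add_continuous.
apply: cvgMl_tmp; apply: cvg_big => [|i _]; first exact: mul_continuous.
exact: Fg.
Qed.

Lemma cvg_truncn_div (e : R) (c : nat) : 0 <= e ->
  (Num.truncn (e * k%:R) - c)%:R / k%:R @[k --> \oo] --> e.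
Proof.
move=> e0; apply/cvgrPdist_le => eps eps0.
near=> k.
have k0 : 0 < k%:R :> R by rewrite ltr0n; near: k; exact: nbhs_infty_gt.
rewrite ler_norml; have ek : 0 <= e * k%:R by exact: mulr_ge0.
have /andP[t1 t2] := truncn_itv ek.
have h : (c.+1)%:R <= eps * k%:R.
  rewrite -ler_pdivrMl// mulrC; near: k; exact: nbhs_infty_ger.
rewrite lerBrDr lerBlDr -(ler_pM2r k0) -[X in _ && X](ler_pM2r k0) !mulrDl mulrVK ?unitfE ?gt_eqF//.
set t := Num.truncn _ in t1 t2 *.
have h1 : (t - c)%:R <= t%:R :> R by rewrite ler_nat leq_subr.
have h2 : t%:R - c%:R <= (t - c)%:R :> R.
  by rewrite lerBlDr -natrD ler_nat; lia.
move: h t2; rewrite -!natr1 mulNr; lra.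
Unshelve. all: by end_near. Qed.

End LatticeVolume.

Section Packing.
Variables (R : realType) (n : nat).
Implicit Types (g : 'M[R]_n) (z : 'cV[int]_n).

Lemma cvg_floor_div (x : R) : (Num.floor (k%:R * x))%:~R / k%:R @[k --> \oo] --> x.
Proof.
apply/cvgrPdist_le => eps eps0.
near=> k.
have k0 : 0 < k%:R :> R by rewrite ltr0n; near: k; exact: nbhs_infty_gt.
have h : 1 <= eps * k%:R.
  rewrite -ler_pdivrMl// mulrC; near: k; exact: nbhs_infty_ger.
have := floor_itv (k%:R * x); rewrite intrD => /andP[f1 f2].
rewrite ler_norml lerBrDr lerBlDr -(ler_pM2r k0) -[X in _ && X](ler_pM2r k0).
rewrite !mulrDl mulrVK ?unitfE ?gt_eqF// mulNr (mulrC x); lra.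
Unshelve. all: by end_near. Qed.

(* The grid points of (1/k) Z^n in the unit cube and in the box, both shrunk
   by O(1/k), are incongruent modulo the lattice of M = floor (k g) / k, hence
   there are at most |det M| of them. *)
Lemma packing_det g (p : 'I_n -> R) (e : R) : g \in unitmx -> 0 <= e <= 1 ->
    (forall z, z != 0 -> exists i, 1 <= `|coor g z i|) ->
    (forall z (x : 'I_n -> R), (forall i, p i <= x i < p i + e) ->
      ~ in_cube (coor g z) x) ->
  1 + e ^+ n <= `|\det g|.
Proof.
move=> ug /andP[e0 e1] gmin gp.
have addKl (a x y : int) : a + x - (a + y) = x - y by lia.
pose B : R := \sum_i `|p i| + 3.
have B3 i : `|p i| + 3 <= B.
  by rewrite lerD2r (bigD1 i)//= ler_wpDr// sumr_ge0.
have B0 : 0 <= B by rewrite addr_ge0 ?sumr_ge0.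
have [K K0 approx] := coor_approx ug B0.
(* A margin of [c1] on each side beats the error [K] between k times a lattice coordinate and its
   integer approximation. *)
set c1 := (Num.truncn K).+2; pose c := (c1 + c1)%N.
have Kc1 : K + 1 <= c1%:R.
  by have /andP[_] := truncn_itv K0; rewrite /c1 -!natr1; lra.
pose b (y : R) (k : nat) := (Num.truncn (y * k%:R) - c)%N.
have ltb y (k x : nat) : 0 <= y -> (x < b y k)%N ->
    x%:R + c1%:R + c1%:R + 1 <= y * k%:R.
  move=> y0; rewrite /b => xb; have yk : 0 <= y * k%:R by exact: mulr_ge0.
  have /andP[+ _] := truncn_itv yk; apply: le_trans.
  by rewrite -!natrD natr1 ler_nat; move: xb; rewrite /c ltn_subRL addnC addnA.
pose M k : 'M[int]_n := \matrix_(i, j) Num.floor (k%:R * g i j).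
pose F k : 'M[R]_n := k%:R^-1 *: int_mx R (M k).
have detF : \det (F k) @[k --> \oo] --> \det g.
  apply: cvg_det => i j; under eq_fun do rewrite !mxE mulrC.
  exact: cvg_floor_div.
have le_card k : (0 < k)%N -> K <= k%:R -> \det (M k) != 0 ->
    (b 1%R k ^ n + b e k ^ n <= `|\det (M k)|)%N.
  move=> k0 Kk dM.
  pose f (t : {ffun 'I_n -> 'I_(b 1%R k)} + {ffun 'I_n -> 'I_(b e k)}) : 'cV[int]_n :=
    match t with
    | inl x => \col_i (x i : nat)%:Z
    | inr x => \col_i (Num.floor (k%:R * p i) + c1%:Z + (x i : nat)%:Z)
    end.
  have k_gt0 : 0 < k%:R :> R by rewrite ltr0n.
  have Mg i j : `|k%:R * g i j - (M k i j)%:~R| <= 1.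
    rewrite mxE; have := floor_itv (k%:R * g i j); rewrite intrD => h.
    by rewrite ler_norml; lra.
  (* A nonzero [z] would have all its lattice coordinates below 1 in absolute value, against
     [gmin]. *)
  have small w z : M k *m z = w ->
      (forall i, `|(w i 0)%:~R| + c1%:R + c1%:R + 1 <= k%:R :> R) -> w = 0.
    move=> Mz wk; have [z0|z0] := eqVneq z 0; first by rewrite -Mz z0 mulmx0.
    have [i] := gmin z z0; rewrite leNgt => /negP[].
    have := approx k (M k) z Kk Mg; rewrite Mz => /(_ _ i) ap.
    rewrite -(ltr_pM2l k_gt0) mulr1 -{1}(gtr0_norm k_gt0) -normrM.
    have {}ap : `|k%:R * coor g z i - (w i 0)%:~R| <= K.
      apply: ap => j; rewrite mulrC (le_trans (y := k%:R * 1))//.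
        by rewrite mulr1; have := wk j; have := K0; lra.
      rewrite ler_wpM2l ?ler0n//; have := B3 j; have := normr_ge0 (p j); lra.
    rewrite -[X in `|X|](subrK (w i 0)%:~R) (le_lt_trans (ler_normD _ _))//.
    by have := wk i; lra.
  have mixed (x : {ffun 'I_n -> 'I_(b e k)}) (y : {ffun 'I_n -> 'I_(b 1%R k)}) z :
      f (inr x) - f (inl y) = M k *m z -> False.
    move=> xyz; have /= ek i := ltb e k (x i) e0 (ltn_ord _).
    have /= y1 i := ltb 1%R k (y i) ler01 (ltn_ord _).
    have w i : ((M k *m z) i 0)%:~R =
        (Num.floor (k%:R * p i))%:~R + c1%:R + (x i)%:R - (y i)%:R :> R.
      by rewrite -xyz !mxE !rmorphD/= rmorphN.
    have fl i : (Num.floor (k%:R * p i))%:~R <= k%:R * p i <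
        (Num.floor (k%:R * p i))%:~R + 1.
      by have := floor_itv (k%:R * p i); rewrite intrD.
    have ap i : `|k%:R * coor g z i - ((M k *m z) i 0)%:~R| <= K.
      apply: approx => // j; rewrite w.
      have h1 : `|k%:R * p j| + 3 * k%:R <= B * k%:R.
        by rewrite normrM gtr0_norm// mulrC -mulrDl ler_wpM2r// ltW.
      have h2 := fl j; have h3 := y1 j; have h4 := ek j.
      have h5 : e * k%:R <= k%:R by rewrite ler_piMl// ltW.
      have h6 : 0 <= (x j)%:R :> R by [].
      have h7 : 0 <= (y j)%:R :> R by [].
      have h8 : 1 <= k%:R :> R by rewrite ler1n.
      have h9 := ler_norm (k%:R * p j); have h10 := lerNnormlW (lexx `|k%:R * p j|).
      by rewrite ler_norml; lra.
    (* This point lies both in the cube at the lattice point of [z] and in the box. *)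
    apply: (gp z (fun i => (y i)%:R / k%:R + coor g z i)) => i /=.
      have := ap i; rewrite w ler_norml => h1; have h2 := fl i; have h4 := ek i.
      rewrite -(ler_pM2l k_gt0) -[X in _ && X](ltr_pM2l k_gt0) !mulrDr.
      rewrite mulrCA divff ?gt_eqF// mulr1 (mulrC _ e).
      have h6 : 0 <= (x i)%:R :> R by [].
      lra.
    rewrite addrC lerDl divr_ge0//= ltrD2l ltr_pdivrMr// mul1r.
    by have := y1 i; lra.
  have -> : (b 1%R k ^ n + b e k ^ n)%N =
     #|{: {ffun 'I_n -> 'I_(b 1%R k)} + {ffun 'I_n -> 'I_(b e k)}}|.
    by rewrite card_sum !card_ffun !card_ord.
  apply: (int_index_le (f := f)) => // s t z stz.
  case: s t stz => [x|x] [y|y] stz.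
  - congr inl; apply/ffunP => i; apply/val_inj.
    have /matrixP/(_ i 0) : f (inl x) - f (inl y) = 0.
      apply: (small _ z) => // j; rewrite !mxE rmorphB/=.
      have /= h1 := ltb 1%R k (x j) ler01 (ltn_ord _).
      have /= h2 := ltb 1%R k (y j) ler01 (ltn_ord _).
      have h6 : 0 <= (x j)%:R :> R by [].
      have h7 : 0 <= (y j)%:R :> R by [].
      have : `|(x j)%:R - (y j)%:R| <= k%:R - c1%:R - c1%:R - 1 :> R.
        by rewrite ler_norml; lra.
      by rewrite -[(_%:Z)%:~R]/(_%:R) -[X in _ - X]/(_%:R); lra.
    by rewrite !mxE => /eqP; rewrite subr_eq0 => /eqP[].
  - by case: (mixed y x (- z)); rewrite mulmxN -stz opprB.
  - by case: (mixed x y z).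
  - congr inr; apply/ffunP => i; apply/val_inj.
    have /matrixP/(_ i 0) : f (inr x) - f (inr y) = 0.
      apply: (small _ z) => // j; rewrite !mxE addKl rmorphB/=.
      have /= h1 := ltb e k (x j) e0 (ltn_ord _).
      have /= h2 := ltb e k (y j) e0 (ltn_ord _).
      have h6 : 0 <= (x j)%:R :> R by [].
      have h7 : 0 <= (y j)%:R :> R by [].
      have h5 : e * k%:R <= k%:R by rewrite ler_piMl// ltW.
      have : `|(x j)%:R - (y j)%:R| <= k%:R - c1%:R - c1%:R - 1 :> R.
        by rewrite ler_norml; lra.
      by rewrite -[(_%:Z)%:~R]/(_%:R) -[X in _ - X]/(_%:R); lra.
    by rewrite !mxE addKl => /eqP; rewrite subr_eq0 => /eqP[].
(* Divided by k^n, the two counts tend to the volumes 1 and e^n. *)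
have limb (y : R) : 0 <= y -> ((b y k)%:R / k%:R) ^+ n @[k --> \oo] --> y ^+ n.
  by move=> y0; exact: (continuous_cvg _ (@exprn_continuous R n y) (cvg_truncn_div c y0)).
have limD : ((b 1 k)%:R / k%:R) ^+ n + ((b e k)%:R / k%:R) ^+ n @[k --> \oo] -->
    1 ^+ n + e ^+ n by apply: cvgD; exact: limb.
rewrite -[X in X + _](expr1n R n).
apply: (ler_cvg_to limD (cvg_norm detF)).
have dF : \forall k \near \oo, \det (F k) != 0.
  apply: (cvgr_neq0 _ detF).
  by move: ug; rewrite unitmxE unitfE.
near=> k.
have k0 : (0 < k)%N by near: k; exact: nbhs_infty_gt.
have k_gt0 : 0 < k%:R :> R by rewrite ltr0n.
have dFk : \det (F k) = k%:R ^- n * (\det (M k))%:~R.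
  by rewrite /F detZ exprVn /int_mx det_map_mx.
have dM : \det (M k) != 0.
  have : \det (F k) != 0 by near: k.
  by rewrite dFk mulf_eq0 negb_or intr_eq0 => /andP[].
rewrite dFk normrM gtr0_norm ?invr_gt0 ?exprn_gt0// [leRHS]mulrC.
rewrite ler_pdivlMr ?exprn_gt0//= mulrDl -!exprMn !mulrVK ?unitfE ?gt_eqF//.
rewrite -intr_norm -natr_absz -!natrX -natrD ler_nat; apply: le_card => //.
by near: k; exact: nbhs_infty_ger.
Unshelve. all: by end_near. Qed.

End Packing.

(** * Lattices with extremal cubes *)

Section Strictness.
Variables (R : realType) (n : nat).
Implicit Types (g : 'M[R]_n) (z : 'cV[int]_n).

(** Equivalently, the half-open unit cubes at the lattice points are pairwise disjoint. *)
Definition lattice_min_ge1 g :=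
  forall z, z != 0 -> exists i, 1 <= `|coor g z i|.

(** Only finitely many cubes come near [p]. Cubes are half-open, so one that misses [p] also misses
    a small box extending upwards from [p]. *)
Lemma uncovered_box g (p : 'I_n -> R) : g \in unitmx ->
    (forall z, ~ in_cube (coor g z) p) ->
  exists e : R, 0 < e <= 1 /\ forall z (x : 'I_n -> R),
    (forall i, p i <= x i < p i + e) -> ~ in_cube (coor g z) x.
Proof.
move=> ug unc; have [H H0 zH] := coor_norm1_le ug.
pose C : R := \sum_i `|p i| + 2.
have HC : 0 <= H * C by rewrite mulr_ge0// addr_ge0 ?sumr_ge0.
have [N HN] : exists N : nat, H * C <= N%:R.
  by exists (Num.truncn (H * C)).+1; have /andP[_ /ltW] := truncn_itv HC.
pose zf (f : {ffun 'I_n -> 'I_(N + N).+1}) : 'cV[int]_n :=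
  \col_i ((f i)%:Z - N%:Z).
have away f : exists e : R, 0 < e /\ forall d (x : 'I_n -> R), d <= e ->
    (forall i, p i <= x i < p i + d) -> ~ in_cube (coor g (zf f)) x.
  have : exists i, ~ (coor g (zf f) i <= p i < coor g (zf f) i + 1).
    by apply/existsNP; exact: unc.
  case=> i /negP; rewrite negb_and -ltNge -leNgt => /orP[lt_i|le_i].
    exists (coor g (zf f) i - p i); rewrite subr_gt0; split=> // d x de px.
    by move/(_ i); have := px i; lra.
  by exists 1; split=> // d x de px; move/(_ i); have := px i; lra.
pose e := \big[Num.min/1]_f sval (cid (away f)).
exists e; split.
  rewrite bigmin_le_id andbT; apply: lt_bigmin => // f _.
  by case: (svalP (cid (away f))).
move=> z x px zx.
have [f zE] : exists f, zf f = z.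
  have zN j : `|z j 0| <= N%:Z.
    rewrite -(ler_int R) intr_norm.
    apply: le_trans HN.
    apply: le_trans (zH z C _) => [|i].
      by rewrite (bigD1 j)//= lerDl sumr_ge0.
    rewrite /C ler_norml.
    have : `|p i| <= \sum_i `|p i| by rewrite (bigD1 i)//= lerDl sumr_ge0.
    have := ler_norm (p i); have := lerNnormlW (lexx `|p i|).
    have := px i; have := zx i; have : e <= 1 by exact: bigmin_le_id.
    by lra.
  exists [ffun j => inord (absz (z j 0 + N%:Z))]; apply/matrixP => j k.
  have := zN j; rewrite ler_norml => zNj.
  rewrite !mxE ffunE inordK; first by rewrite ord1; lia.
  by lia.
have [_ fe] := svalP (cid (away f)); apply: (fe e x) => //; last by rewrite zE.
exact: bigmin_le.
Qed.

(** Disjointness is the hypothesis on the minimum. An uncovered point would leave a whole box free,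
    and [packing_det] would then give |det g| > 1. *)
Lemma min_ge1_cube_tiling g : g \in unitmx -> lattice_min_ge1 g ->
  `|\det g| <= 1 -> cube_tiling (coor g).
Proof.
move=> ug gmin dg; split=> [p|p a b ap bp].
  apply: contrapT => /forallNP /(uncovered_box ug)[e [/andP[e0 e1] pe]].
  have := packing_det ug _ gmin pe; rewrite (ltW e0) e1 => /(_ isT).
  by apply/negP; rewrite -ltNge (le_lt_trans dg)// ltrDl exprn_gt0.
apply/eqP; rewrite -subr_eq0; apply/negPn/negP => /gmin[i].
by rewrite coorB ler_normr; have := ap i; have := bp i; lra.
Qed.

(** Keller's theorem is applied to the cubes at 0 and [z]; without integer coordinates its
    hypothesis is vacuous. *)
Lemma min_ge1_int_coor g z : g \in unitmx -> lattice_min_ge1 g ->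
  `|\det g| <= 1 -> z != 0 -> exists i, coor g z i \is a Num.int.
Proof.
move=> ug gmin dg; apply: contraNP => /forallNP zint.
have tg := min_ge1_cube_tiling ug gmin dg.
suff -> : z = 0 by [].
apply/esym/(cube_tiling_keller tg) => i.
rewrite -coorB subr0 => /zint; exact.
Qed.

(* Two of the vectors (1, m, 0, ..) have an integer coordinate at the same
   place i, so the first two entries of row i of g are rationally dependent. *)
Lemma min_ge1_det_gt1 g : (1 < n)%N -> g \in unitmx -> lattice_min_ge1 g ->
    (forall z i, z != 0 -> coor g z i != 0) ->
  1 < `|\det g|.
Proof.
move=> n1 ug gmin gn0; rewrite ltNge; apply/negP => dg.
pose i0 : 'I_n := Ordinal (ltnW n1); pose i1 : 'I_n := Ordinal n1.
have i10 : i1 != i0 by [].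
pose v (a b : int) : 'cV[int]_n := \col_i (a *+ (i == i0) + b *+ (i == i1)).
have vE a b i : coor g (v a b) i = a%:~R * g i i0 + b%:~R * g i i1.
  rewrite coorE (bigD1 i0)//= (bigD1 i1)//= big1 ?addr0 => [|j /andP[j0 j1]].
    rewrite !mxE !eqxx (negbTE i10) eq_sym (negbTE i10).
    by rewrite !mulr1n !mulr0n addr0 add0r !(mulrC (g _ _)).
  by rewrite mxE (negbTE j0) (negbTE j1) mulr0n addr0 mulr0.
have v0 a b : (a != 0) || (b != 0) -> v a b != 0.
  apply: contraTN => /eqP/matrixP vab; have := vab i0 0; have := vab i1 0.
  rewrite !mxE !eqxx (negbTE i10) eq_sym (negbTE i10) !mulr1n !mulr0n.
  by rewrite addr0 add0r => -> ->.
have ex (m : 'I_n.+1) : exists i, coor g (v 1 m%:Z) i \is a Num.int.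
  by apply: min_ge1_int_coor => //; exact: v0.
pose h m := sval (cid (ex m)).
(* Pigeonhole: n + 1 vectors for n rows. *)
have : ~~ injectiveb h.
  by apply/negP => /injectiveP/leq_card; rewrite !card_ord ltnn.
case/injectivePn => m [m' mm' hm].
have /intrP[t tE] := svalP (cid (ex m)).
have /intrP[t' tE'] := svalP (cid (ex m')).
move: tE tE'; rewrite -/(h m) -/(h m') -hm; set i := h m; rewrite !vE.
rewrite !mul1r => tE tE'; pose d := m%:Z - m'%:Z; pose s := t - t'.
have d0 : d != 0 by rewrite subr_eq0; apply: contra mm' => /eqP[] /val_inj ->.
have dR0 : d%:~R != 0 :> R by rewrite intr_eq0.
have dE : d%:~R * g i i1 = s%:~R.
  by rewrite /d /s !rmorphB/= -tE -tE'; ring.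
have s0 : s != 0.
  have := gn0 (v 0 1) i (v0 0 1 isT); rewrite vE mul0r add0r mul1r => gi1.
  by rewrite -(intr_eq0 R) -dE mulf_neq0.
clearbody d s.
(* As [t] is [g i i0] plus m times [g i i1], and d times [g i i1] is [s], the [i]-th coordinate of
   this nonzero vector is s t - t s = 0. *)
have := gn0 (v s (m%:Z * s - d * t)) i; rewrite v0 ?s0// => /(_ isT)/eqP; apply.
rewrite vE; apply: (mulfI dR0); rewrite mulr0.
rewrite rmorphB !rmorphM/= -tE -dE; ring.
Qed.

End Strictness.

(** * Diagonal stabilizers *)

Section LogStabilizer.
Variables (R : realType) (n : nat).
Implicit Types (g : 'M[R]_n) (z : 'cV[int]_n) (l v y : 'rV[R]_n).

Definition dexp v : 'M[R]_n := diag_mx (map_mx expR v).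

Lemma dexp0 : dexp 0 = 1%:M.
Proof. by apply/matrixP => i j; rewrite !mxE expR0. Qed.

Lemma dexpD v l : dexp (v + l) = dexp v *m dexp l.
Proof.
rewrite mulmx_diag; congr diag_mx; apply/rowP => i.
by rewrite !mxE expRD.
Qed.

Lemma det_dexp v : \det (dexp v) = expR (\sum_i v 0 i).
Proof.
rewrite det_diag expR_sum; apply: eq_bigr => i _; by rewrite mxE.
Qed.

Lemma dexp_unit v : dexp v \in unitmx.
Proof. by rewrite unitmxE det_dexp unitfE gt_eqF ?expR_gt0. Qed.

Lemma coor_dexp v g z i : coor (dexp v *m g) z i = expR (v 0 i) * coor g z i.
Proof. by rewrite /coor -mulmxA mul_diag_mx mxE mxE. Qed.

Lemma coor_mulmx g (W : 'M[int]_n) z i :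
  coor (g *m int_mx R W) z i = coor g (W *m z) i.
Proof. by rewrite /coor -mulmxA -map_mxM. Qed.

Lemma coor_eq0 g z : g \in unitmx -> (forall i, coor g z i = 0) -> z = 0.
Proof.
move=> ug gz; have : g *m int_mx R z = 0.
  by apply/matrixP => i j; rewrite ord1 [RHS]mxE; exact: gz.
move/(congr1 (mulmx (invmx g))); rewrite mulKmx// mulmx0 => /matrixP z0.
apply/matrixP => i j; have := z0 i j; rewrite !mxE => /eqP.
by rewrite intr_eq0 => /eqP.
Qed.

(** [W] is only integral, so the diagonal matrix maps the lattice into itself; stabilizing it means
    asking for both [l] and [- l]. *)
Definition log_stab g l := exists W : 'M[int]_n, dexp l *m g = g *m int_mx R W.

Lemma coor_stab g l (W : 'M[int]_n) z i : dexp l *m g = g *m int_mx R W ->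
  coor g (W *m z) i = expR (l 0 i) * coor g z i.
Proof. by move=> lW; rewrite -coor_mulmx -lW coor_dexp. Qed.

Lemma stab_neq0 g l (W : 'M[int]_n) z : g \in unitmx ->
  dexp l *m g = g *m int_mx R W -> z != 0 -> W *m z != 0.
Proof.
move=> ug lW; apply: contra => /eqP Wz; apply/eqP; apply: (coor_eq0 ug) => j.
have := coor_stab z j lW; rewrite Wz coorE big1 => [/esym/eqP|k _].
  by rewrite mulf_eq0 gt_eqF ?expR_gt0//= => /eqP.
by rewrite mxE mulr0.
Qed.

Lemma log_stab0 g : log_stab g 0.
Proof. by exists 1%:M; rewrite dexp0 mul1mx /int_mx map_mx1 mulmx1. Qed.

Lemma log_stabD g l l' : log_stab g l -> log_stab g l' -> log_stab g (l + l').
Proof.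
move=> [W lW] [W' lW']; exists (W *m W').
by rewrite dexpD -mulmxA lW' mulmxA lW /int_mx map_mxM mulmxA.
Qed.

(** The two integer matrices are inverse to each other, so their determinants are 1 or -1, and the
    positive [\det (dexp l)] must be 1. *)
Lemma log_stab_sum0 g l : g \in unitmx -> log_stab g l -> log_stab g (- l) ->
  \sum_i l 0 i = 0.
Proof.
move=> ug [W lW] [W' lW'].
have WW' : W *m W' = 1%:M.
  have : g *m int_mx R (W *m W') = g.
    by rewrite /int_mx map_mxM mulmxA -lW -mulmxA -lW' mulmxA -dexpD subrr dexp0 mul1mx.
  move/(congr1 (mulmx (invmx g))); rewrite mulKmx// mulVmx// => /matrixP WW'.
  apply/matrixP => i j; apply: (@intr_inj R); have := WW' i j.
  by rewrite mxE => ->; rewrite !mxE; case: (_ == _).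
have detW : `|\det W| = 1.
  have : \det W * \det W' = 1 by rewrite -det_mulmx WW' det1.
  move=> dW; have : \det W \is a GRing.unit.
    by apply/unitrPr; exists (\det W').
  by move=> /orP[] /eqP ->.
have dg : \det g != 0 by move: ug; rewrite unitmxE unitfE.
have dlW : \det (dexp l) = (\det W)%:~R.
  apply: (mulfI dg); rewrite mulrC -det_mulmx lW det_mulmx.
  by rewrite /int_mx det_map_mx.
apply: expR_inj; rewrite expR0.
by rewrite -[LHS](gtr0_norm (expR_gt0 _)) -det_dexp dlW -intr_norm detW.
Qed.

(** Logarithms identify A with the sum-zero hyperplane; cocompactness of the stabilizer there is
    expressed by bounded distance. *)
Definition log_cocompact g := exists C : R, forall y, \sum_i y 0 i = 0 ->
  exists l, [/\ log_stab g l, log_stab g (- l), \sum_i l 0 i = 0 &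
                forall i, `|y 0 i + l 0 i| <= C].

(* If a nonzero lattice vector had a vanishing coordinate, the diagonal group
   could contract it to 0, while modulo the stabilizer it moves the lattice
   only within a bounded set of lattices. *)
Lemma log_cocompact_coor_neq0 g z i : g \in unitmx -> log_cocompact g ->
  z != 0 -> coor g z i != 0.
Proof.
move=> ug [C gC] z0; apply/eqP => gzi.
have [H H0 zH] := coor_norm1_le ug.
pose M := \sum_j `|coor g z j|; pose t := H * (expR C * M).
have t0 : 0 <= t by rewrite !mulr_ge0 ?expR_ge0// sumr_ge0.
(* This direction contracts every coordinate except the [i]-th, where [z] has nothing to expand. *)
pose y : 'rV[R]_n := \row_j (if j == i then t *+ n.-1 else - t).
have /gC[l [_ [W lW] _ yl]] : \sum_j y 0 j = 0.
  rewrite (bigD1 i)//= mxE eqxx (eq_bigr (fun=> - t)) => [|j ji].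
    by rewrite sumr_const cardC1 card_ord mulNrn subrr.
  by rewrite mxE (negbTE ji).
have coorW j : coor g (W *m z) j = expR (- l 0 j) * coor g z j.
  by rewrite (coor_stab z j lW) mxE.
have Wz0 := stab_neq0 ug lW z0.
have : \sum_j `|((W *m z) j 0)%:~R| <= H * (expR (C - t) * M).
  apply: zH => j; rewrite coorW normrM gtr0_norm ?expR_gt0//.
  have [->|ji] := eqVneq j i.
    by rewrite gzi normr0 mulr0 mulr_ge0 ?expR_ge0// sumr_ge0.
  apply: ler_pM; rewrite ?expR_ge0//.
    have := yl j; rewrite mxE (negbTE ji) ler_expR ler_norml; lra.
  by rewrite /M (bigD1 j)//= lerDl sumr_ge0.
have [j Wzj] : exists j, (W *m z) j 0 != 0.
  apply/existsP; apply: contraNT Wz0; rewrite negb_exists => /forallP Wz.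
  by apply/eqP/matrixP => j k; rewrite ord1 [RHS]mxE; apply/eqP/negPn/Wz.
have : 1 <= \sum_j `|((W *m z) j 0)%:~R| :> R.
  rewrite (bigD1 j)//= ler_wpDr ?sumr_ge0// -intr_norm ler1z.
  by rewrite -gtz0_ge1 normr_gt0.
(* The two bounds combine to 1 <= t exp(-t), impossible since exp t >= 1 + t. *)
move=> /le_trans h /h; rewrite expRD -mulrA mulrCA mulrC -!mulrA.
rewrite (mulrC (expR (- t))) !mulrA expRN ler_pdivlMr ?expR_gt0// mul1r.
have -> : H * M * expR C = t by rewrite /t; ring.
have := expR_ge1Dx t; lra.
Qed.

Definition box_free g (a : 'I_n -> R) :=
  forall z, z != 0 -> exists i, a i <= `|coor g z i|.

Lemma box_free_stab g v l : g \in unitmx -> log_stab g (- l) ->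
  box_free g (fun i => expR (v 0 i)) -> box_free g (fun i => expR ((v + l) 0 i)).
Proof.
move=> ug [W lW] gv z z0.
have coorW j : coor g (W *m z) j = expR (- l 0 j) * coor g z j.
  by rewrite (coor_stab z j lW) mxE.
have Wz0 := stab_neq0 ug lW z0.
have [i vi] := gv _ Wz0; exists i; rewrite mxE expRD -ler_pdivlMr ?expR_gt0//.
by rewrite -expRN mulrC; move: vi; rewrite coorW normrM gtr0_norm ?expR_gt0.
Qed.

Lemma box_free_min_ge1 g v : box_free g (fun i => expR (v 0 i)) ->
  lattice_min_ge1 (dexp (- v) *m g).
Proof.
move=> gv z /gv[i vi]; exists i; rewrite coor_dexp mxE expRN normrM.
by rewrite gtr0_norm ?invr_gt0 ?expR_gt0// ler_pdivlMl ?expR_gt0// mulr1.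
Qed.

(** Rescaling the box to the unit cube gives a lattice of minimum at least 1, without vanishing
    coordinates, whose covolume is the exponential of minus the sum; [min_ge1_det_gt1] makes it
    exceed 1. *)
Lemma box_free_sum_lt0 g v : (1 < n)%N -> \det g = 1 ->
    (forall z i, z != 0 -> coor g z i != 0) ->
  box_free g (fun i => expR (v 0 i)) -> \sum_i v 0 i < 0.
Proof.
move=> n1 dg gn0 /box_free_min_ge1 gv.
have ug : g \in unitmx by rewrite unitmxE dg unitr1.
have := min_ge1_det_gt1 n1 _ gv; rewrite unitmx_mul dexp_unit ug => /(_ isT).
rewrite det_mulmx dg mulr1 det_dexp gtr0_norm ?expR_gt0// -{1}(expR0 R).
rewrite ltr_expR => gt0; rewrite -oppr_gt0 -sumrN.
rewrite (eq_bigr (fun i => (- v) 0 i)) => [|i _]; last by rewrite mxE.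
apply: gt0 => z i z0; rewrite coor_dexp mulf_neq0 ?gn0//.
by rewrite gt_eqF ?expR_gt0.
Qed.

End LogStabilizer.

(** * The Mordell constant *)

Section Kappa.
Variables (R : realType) (n : nat).
Implicit Types (g : 'M[R]_n) (z : 'cV[int]_n) (l v y : 'rV[R]_n).

Lemma admissible_box_free g (a : 'I_n -> R) : g \in unitmx ->
  admissible (lattice_of g) a -> box_free g a.
Proof.
move=> ug ga z z0; apply: contrapT => /forallNP za.
have gz0 : g *m int_mx R z != 0.
  apply: contra z0 => /eqP gz; apply/eqP; apply: (coor_eq0 ug) => i.
  by rewrite /coor gz mxE.
apply: (ga _ _ gz0); first by exists z.
exists (fun i _ => `](- a i), (a i)[%classic) => [i j|/= x xa i] /=.
  apply: near_in_itvoo; rewrite in_itv/= ord1 -ltr_norml ltNge.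
  exact/negP/za.
by have := xa i 0; rewrite in_itv/= => /andP[/ltW -> /ltW ->].
Qed.

(** The strict inequality keeps nonzero points out of the closed box, hence out of its interior. *)
Lemma box_free_admissible g (a : 'I_n -> R) :
    (forall z, z != 0 -> exists i, a i < `|coor g z i|) ->
  admissible (lattice_of g) a.
Proof.
move=> ga _ [z _ <-] gz0 /interior_subset /= za.
have [|i] := ga z.
  apply: contra gz0 => /eqP ->; apply/eqP/matrixP => i j.
  by rewrite ord1 -[LHS]/(coor g 0 i) coorE big1 ?mxE// => k _; rewrite mxE mulr0.
by rewrite ltNge ler_norml za.
Qed.

Lemma closed_box_free g : closed [set v : 'rV[R]_n | box_free g (fun i => expR (v 0 i))].
Proof.
rewrite (_ : [set v | _] = \bigcap_(z in [set z | z != 0])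
    \big[setU/set0]_(i < n)
      ((fun v : 'rV[R]_n => expR (v 0 i)) @^-1` [set x | x <= `|coor g z i|])).
  apply: closed_bigI => z _; apply: closed_bigsetU => i _.
  apply: preimage_closed; last exact: closed_le.
  move=> v _; apply: continuous_comp; first exact: coord_continuous.
  exact: continuous_expR.
apply/seteqP; split=> v /= vf z /vf.
  by case=> i vi; rewrite -bigcup_seq; exists i => //=; rewrite mem_index_enum.
by rewrite -bigcup_seq => -[i _ vi]; exists i.
Qed.

Lemma continuous_sum_coord : continuous (fun v : 'rV[R]_n => \sum_i v 0 i).
Proof.
apply: continuous_big => [|i _]; first exact: add_continuous.
exact: coord_continuous.
Qed.

(** Stabilizing shifts preserve box-freeness and the sum, and bring each coordinate of [v] within
    [C] of the mean. Unless the sum is at most -n, it is thus a value taken on a compact set, where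
    the maximum is attained and negative. *)
Lemma box_free_sum_bound g : (1 < n)%N -> \det g = 1 -> log_cocompact g ->
  exists2 s : R, s < 0 &
    forall v, box_free g (fun i => expR (v 0 i)) -> \sum_i v 0 i <= s.
Proof.
move=> n1 dg cg; have [C gC] := cg.
have ug : g \in unitmx by rewrite unitmxE dg unitr1.
have gn0 z i : z != 0 -> coor g z i != 0 by exact: log_cocompact_coor_neq0.
have neg := box_free_sum_lt0 n1 dg gn0.
have n0 : 0 < n%:R :> R by rewrite ltr0n ltnW.
(* The interval is what remains when the mean lies between -1 and 0. *)
pose A : set 'rV[R]_n := [set v : 'rV[R]_n | forall i, `[-1 - C, C]%classic (v 0 i)] `&`
  [set v : 'rV[R]_n | box_free g (fun i => expR (v 0 i))].
have cA : compact A.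
  apply: compact_closedI; last exact: closed_box_free.
  by apply: (@rV_compact R n (fun=> `[-1 - C, C]%classic)) => i; exact: segment_compact.
have red v : box_free g (fun i => expR (v 0 i)) ->
    \sum_i v 0 i <= - n%:R \/ exists2 v', A v' & \sum_i v' 0 i = \sum_i v 0 i.
  move=> gv; pose mu := (\sum_i v 0 i) / n%:R.
  have [mu1|mu1] := leP mu (-1).
    by left; move: mu1; rewrite ler_pdivrMr// mulN1r.
  have mu0 : mu < 0 by rewrite pmulr_llt0 ?invr_gt0// neg.
  right; pose y : 'rV[R]_n := v - const_mx mu.
  have /gC[l [_ gl l0 yl]] : \sum_i y 0 i = 0.
    under eq_bigr do rewrite !mxE.
    by rewrite sumrB sumr_const card_ord -mulr_natr mulrVK ?subrr// unitfE gt_eqF.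
  exists (v + l); last first.
    by under eq_bigr do rewrite mxE; rewrite big_split/= l0 addr0.
  split=> [i|]; last exact: box_free_stab.
  by have := yl i; rewrite /= in_itv/= !mxE ler_norml; lra.
have [A0|/set0P/negP/negPn/eqP A0] := pselect (A !=set0); last first.
  exists (- n%:R); first by rewrite oppr_lt0.
  by move=> v /red[//|[v']]; rewrite A0.
have [w + wmax] := compact_EVT_max A0 cA (continuous_subspaceT continuous_sum_coord).
rewrite inE => -[_ /neg w0].
exists (Num.max (- n%:R) (\sum_i w 0 i)); first by rewrite gt_max oppr_lt0 n0.
move=> v /red[h|[v' Av' <-]]; rewrite le_max ?h//.
by rewrite wmax ?orbT// inE.
Qed.

Lemma box_volumeE g (a : 'I_n -> R) : \det g = 1 ->
  box_volume a / (2 ^+ n * covolume (lattice_of g)) = \prod_i a i.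
Proof.
move=> dg; rewrite covolumeE ?unitmxE ?dg ?unitr1// normr1 mulr1.
rewrite /box_volume big_split/= prodr_const card_ord mulrAC divff ?mul1r//.
Qed.

Lemma kappa_bounds g : (1 < n)%N -> \det g = 1 -> log_cocompact g ->
  kappa (lattice_of g) < 1 /\
  forall a, (forall i, 0 < a i) ->
    (forall z, z != 0 -> exists i, a i < `|coor g z i|) ->
  \prod_i a i <= kappa (lattice_of g).
Proof.
move=> n1 dg cg; have [s s0 gs] := box_free_sum_bound n1 dg cg.
have ug : g \in unitmx by rewrite unitmxE dg unitr1.
rewrite /kappa; set S := [set _ | _ in _].
have Ss : ubound S (expR s).
  move=> _ [a [a0 ga] <-]; rewrite box_volumeE//.
  have := gs (\row_i ln (a i)); rewrite (_ : \prod_i a i = expR (\sum_i (\row_i ln (a i)) 0 i)).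
    move=> H; rewrite ler_expR; apply: H => z z0; have [i ai] := admissible_box_free ug ga z0.
    by exists i; rewrite mxE lnK ?posrE.
  by rewrite expR_sum; apply: eq_bigr => i _; rewrite mxE lnK ?posrE.
split=> [|a a0 ga].
  (* On the empty set [sup] takes its default value 0, which is below 1 too. *)
  have [S0|/set0P/negP/negPn/eqP ->] := pselect (S !=set0); last by rewrite sup0.
  by apply: le_lt_trans (ge_sup S0 Ss) _; rewrite -[ltRHS]expR0 ltr_expR.
apply: ub_le_sup; first by exists (expR s).
by exists a; rewrite ?box_volumeE//; split=> //; exact: box_free_admissible.
Qed.

End Kappa.

(** * Compact orbits *)

Section Orbit.
Variables (R : realType) (n : nat).
Implicit Types (g : 'M[R]_n) (z : 'cV[int]_n) (l v y : 'rV[R]_n).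

Lemma lattice_ofM (A B : 'M[R]_n) :
  lattice_of (A *m B) = [set A *m x | x in lattice_of B].
Proof.
apply/seteqP; split => [_ [z _ <-]|_ [_ [z _ <-] <-]].
  by exists (B *m int_mx R z); rewrite ?mulmxA//; exists z.
by exists z; rewrite ?mulmxA.
Qed.

Lemma lattice_of_stab g l : log_stab g l -> log_stab g (- l) ->
  lattice_of (dexp l *m g) = lattice_of g.
Proof.
have sub h (W : 'M[int]_n) : lattice_of (h *m int_mx R W) `<=` lattice_of h.
  by move=> _ [z _ <-]; exists (W *m z) => //; rewrite -mulmxA -map_mxM.
move=> [W lW] [W' lW']; apply/seteqP; split; first by rewrite lW; exact: sub.
rewrite -{1}[g]mul1mx -dexp0 -(subrr l) dexpD -mulmxA lW' mulmxA; exact: sub.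
Qed.

Definition to_SL g (dg : \det g = 1) : SL R n := SigSub (mem_set dg).

Definition to_lattice g (dg : \det g = 1) : lattice_space R n :=
  (\pi_{eq_quot (@same_coset_equiv R n)} (to_SL dg))%qT.

Lemma lattice_to_lattice g (dg : \det g = 1) :
  lattice (to_lattice dg) = lattice_of g.
Proof. exact: lattice_pi. Qed.

(** Both bases have determinant 1, hence so has the integer change of basis, and the cosets
    agree. *)
Lemma lattice_inj : injective (@lattice R n).
Proof.
move=> L M; rewrite /lattice => /lattice_of_eq[z zE].
rewrite -[L]reprK -[M]reprK; apply/eqmodP; apply/asboolP; exists z => //.
move: (repr L) (repr M) zE => [g gSL] [h hSL] /= hE.
have dg : \det g = 1 := set_mem gSL; have dh : \det h = 1 := set_mem hSL.
apply: (@intr_inj R); have := dh.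
by rewrite hE det_mulmx dg mul1r /int_mx det_map_mx.
Qed.

Lemma continuous_mx (T : topologicalType) m p (F : T -> 'M[R]_(m, p)) :
  (forall i j, continuous (fun x => F x i j)) -> continuous F.
Proof.
move=> cF x A [P PF PA]; apply: filterS (_ : \near x, forall i j, P i j (F x i j)).
  by move=> t; exact: PA.
by apply: filter_forall => i; apply: filter_forall => j; exact: (cF i j).
Qed.

(** Projection to the sum-zero hyperplane; it lets the orbit be parametrized by all of R^n rather
    than by a subtype. *)
Definition center y : 'rV[R]_n := y - const_mx ((\sum_i y 0 i) / n%:R).

Lemma sum_center y : (0 < n)%N -> \sum_i center y 0 i = 0.
Proof.
move=> n0; rewrite /center; set mu := _ / _; under eq_bigr do rewrite !mxE.
by rewrite sumrB sumr_const card_ord -mulr_natr mulrVK ?subrr// unitfE pnatr_eq0 -lt0n.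
Qed.

Lemma center_id y : \sum_i y 0 i = 0 -> center y = y.
Proof. by move=> y0; rewrite /center y0 mul0r; apply/rowP => i; rewrite !mxE subr0. Qed.

(** The orbit is the continuous image of the cube [K]: a stabilizing shift moves the logarithm of
    any element of A into [K]. *)
Lemma log_cocompact_number_field g (dg : \det g = 1) : (0 < n)%N ->
  log_cocompact g -> number_field_lattice (to_lattice dg).
Proof.
move=> n0 [C gC].
have dE y : \det (dexp (center y) *m g) = 1.
  by rewrite det_mulmx dg mulr1 det_dexp sum_center// expR0.
pose K := [set y : 'rV[R]_n | forall i, `[- C, C]%classic (y 0 i)].
have cK : compact K.
  by apply: (@rV_compact R n (fun=> `[- C, C]%classic)) => i; exact: segment_compact.
have cE : continuous (fun y => to_lattice (dE y)).
  have cSL : continuous (fun y => to_SL (dE y)).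
    apply: continuous_comp_initial; apply: continuous_mx => i j.
    rewrite (_ : (fun _ => _) = fun y : 'rV[R]_n =>
        expR (y 0 i - (\sum_k y 0 k) / n%:R) * g i j); last first.
      by apply/funext => y; rewrite -[LHS]/((dexp (center y) *m g) i j) mul_diag_mx !mxE.
    move=> y; apply: (@cvgMr_tmp _ _ (nbhs y)).
    apply: continuous_comp; last exact: continuous_expR.
    apply: (@cvgB _ _ _ (nbhs y)); first exact: coord_continuous.
    by apply: (@cvgMr_tmp _ _ (nbhs y)); exact: continuous_sum_coord.
  by move=> y; apply: continuous_comp; [exact: cSL|exact: pi_continuous].
rewrite /number_field_lattice.
suff -> : diag_orbit (to_lattice dg) = [set to_lattice (dE y) | y in K].
  by apply: continuous_compact => //; exact: continuous_subspaceT.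
apply/seteqP; split=> [M [a [/is_diag_mxP aD a0 da]]|_ [y _ <-]].
  rewrite lattice_to_lattice -lattice_ofM => ME.
  pose v : 'rV[R]_n := \row_i ln (a i i).
  have av : a = dexp v.
    apply/matrixP => i j; rewrite !mxE; have [->|ij] := eqVneq i j.
      by rewrite mulr1n lnK ?posrE.
    by rewrite mulr0n aD.
  have v0 : \sum_i v 0 i = 0.
    by apply: expR_inj; rewrite -det_dexp -av da expR0.
  have [l [gl gNl l0 vl]] := gC v v0.
  exists (v + l).
    by move=> i; have := vl i; rewrite /= in_itv/= [(v + l) 0 i]mxE ler_norml.
  apply: lattice_inj; rewrite lattice_to_lattice ME center_id.
    by rewrite av dexpD -mulmxA lattice_ofM lattice_of_stab// -lattice_ofM.
  by under eq_bigr => i _ do rewrite [(v + l) 0 i]mxE; rewrite big_split/= v0 l0 addr0.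
exists (dexp (center y)); last by rewrite !lattice_to_lattice lattice_ofM.
split.
- exact: diag_mx_is_diag.
- by move=> i; rewrite !mxE eqxx mulr1n expR_gt0.
- by rewrite det_dexp sum_center// expR0.
Qed.

(** A lattice vector supported on a proper set of coordinates has a vanishing coordinate, hence is
    0; a decomposable lattice would then be trivial. *)
Lemma not_decomposable g : (0 < n)%N -> g \in unitmx ->
    (forall z i, z != 0 -> coor g z i != 0) ->
  ~ decomposable (lattice_of g).
Proof.
move=> n0 ug gn0 [I [/card_gt0P[i iI] /card_gt0P[j jI] gI]].
have null z k : coor g z k = 0 -> z = 0.
  by move=> zk; apply/eqP; apply: contraPT zk => /gn0 zk; exact/eqP.
pose e : 'cV[int]_n := const_mx 1.
have : lattice_of g (g *m int_mx R e) by exists e.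
rewrite gI => -[_ [[z _ <-] zI]] [_ [[w _ <-] wI]].
have z0 : z = 0 by apply: (null _ j); apply: zI; rewrite !inE in jI.
have w0 : w = 0 by apply: (null _ i); apply: wI; rewrite !inE negbK.
rewrite z0 w0 /int_mx map_mx0 mulmx0 addr0 => /esym/(congr1 (mulmx (invmx g))).
rewrite mulKmx// mulmx0 => /matrixP/(_ i 0); rewrite !mxE.
by apply/eqP; rewrite oner_neq0.
Qed.

End Orbit.

(** * A lattice from units *)

Section EigenLattice.
Variables (R : realType) (n : nat) (a : 'I_n -> int) (theta : 'I_n -> R) (c : R).
Let t i k : R := theta i - (a k)%:~R.
Hypothesis n_gt0 : (0 < n)%N.
Hypothesis c_gt1 : 1 < c.
Hypothesis prod_t : forall i, \prod_k t i k = 1.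
Hypothesis t_large : forall i k, i != k -> c <= `|t i k|.

Lemma sub_theta_neq0 i k : t i k != 0.
Proof.
apply/negP => /eqP tik; have := prod_t i.
by rewrite (bigD1 k)//= tik mul0r => /esym/eqP; rewrite oner_eq0.
Qed.

Lemma prod_sub_ge i (P : pred 'I_n) j : ~~ P i -> P j ->
  c <= `|\prod_(k | P k) t i k|.
Proof.
move=> Pi Pj; rewrite (bigD1 j)//= normrM -[leLHS]mulr1.
have tl k : P k -> c <= `|t i k|.
  by move=> Pk; apply: t_large; apply: contraNneq Pi => ->.
apply: ler_pM; rewrite ?ler01 ?tl//; first by rewrite (le_trans ler01)// ltW.
rewrite normr_prod; elim/big_ind : _ => // [x y|k /andP[/tl]].
  exact: mulr_ege1.
by move=> ck _; rewrite (le_trans _ ck)// ltW.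
Qed.

(* The Newton basis of Z[theta], in which multiplication by theta is the sum
   of a diagonal matrix and a cyclic permutation, as prod_k (theta - a_k) = 1. *)
Definition newton i (j : nat) : R := \prod_(k < n | (k < j)%N) t i k.

Lemma newton_neq0 i j : newton i j != 0.
Proof. by apply/prodf_neq0 => k _; exact: sub_theta_neq0. Qed.

(** The cyclic step from the last index to 0 holds because the full product is 1, as is the empty
    one. *)
Lemma newtonS i (j : 'I_n) : newton i (ordS j) = newton i j * t i j.
Proof.
have newton1 : newton i j.+1 = newton i j * t i j.
  rewrite /newton (bigD1 j)//= mulrC; congr (_ * _); apply: eq_bigl => k.
  by rewrite ltnS -val_eqE /= ltn_neqAle andbC.
rewrite -newton1 /=; have := ltn_ord j; rewrite leq_eqVlt => /orP[/eqP jn|jn].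
  rewrite jn modnn /newton big_pred0 ?(eq_bigl predT) ?prod_t//.
  by move=> k; rewrite ltn_ord.
by rewrite modn_small.
Qed.

Lemma newton_ratio i (j j' : nat) : (j <= j')%N ->
  newton i j' = newton i j * \prod_(k < n | (j <= k < j')%N) t i k.
Proof.
move=> jj'; rewrite /newton (bigID (fun k : 'I_n => (k < j)%N))/=; congr (_ * _).
  by apply: eq_bigl => k; rewrite andbC; case: ltnP => //= /leq_trans ->.
by apply: eq_bigl => k; rewrite -leqNgt andbC.
Qed.

Definition newton_mx : 'M[R]_n := \matrix_(i, j) newton i j.

(* The Newton basis rescaled to ones on the diagonal. Any other entry is
   the inverse of a nonempty product of theta_i - a_k with k != i. *)
Definition near_id : 'M[R]_n := \matrix_(i, j) (newton i j / newton i i).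

Lemma near_idE : near_id = diag_mx (\row_i (newton i i)^-1) *m newton_mx.
Proof. by apply/matrixP => i j; rewrite mul_diag_mx !mxE mulrC. Qed.

Lemma near_id_le i j : `|near_id i j - (i == j)%:R| <= c^-1.
Proof.
have c0 : 0 < c by rewrite (lt_trans ltr01).
rewrite mxE; have [<-|ij] := eqVneq i j.
  by rewrite divff ?newton_neq0// subrr normr0 invr_ge0 ltW.
rewrite subr0; move: ij; rewrite -val_eqE /= neq_ltn => /orP[ij|ij].
  (* Above the diagonal the product contains the factor [t i i]; it is the inverse of the
     complementary product, which omits that factor. *)
  rewrite (newton_ratio _ (ltnW ij)) mulrAC divff ?newton_neq0// mul1r.
  set x := \prod_(_ < n | _) _.
  have : x * \prod_(k < n | ~~ (i <= k < j)%N) t i k = 1.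
    by rewrite -[RHS](prod_t i) [RHS](bigID (fun k : 'I_n => (i <= k < j)%N)).
  set y := \prod_(_ < n | _) _ => xy.
  have cy : c <= `|y| by apply: (prod_sub_ge (j := j)); rewrite ?leqnn ?ij ?ltnn ?andbF.
  have y0 : 0 < `|y| by rewrite (lt_le_trans c0).
  have -> : `|x| = `|y|^-1.
    by apply: (mulIf (lt0r_neq0 y0)); rewrite -normrM xy normr1 mulVf ?gt_eqF.
  by rewrite lef_pV2 ?posrE.
rewrite [X in _ / X](newton_ratio _ (ltnW ij)) invfM mulVKf ?newton_neq0//.
set y := \prod_(_ < n | _) _.
have cy : c <= `|y| by apply: (prod_sub_ge (j := j)); rewrite ?ltnn ?andbF ?leqnn.
have y0 : 0 < `|y| by rewrite (lt_le_trans c0).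
by rewrite normfV lef_pV2 ?posrE.
Qed.

(** Multiplication by theta - a_m in the Newton basis, from theta - a_m = (theta - a_j) + (a_j -
    a_m). *)
Definition newton_shift_mx m : 'M[int]_n :=
  \matrix_(l, j) ((a j - a m) *+ (l == j) + (l == ordS j)%:R).

Lemma newton_mx_eigen m :
  diag_mx (\row_i t i m) *m newton_mx = newton_mx *m int_mx R (newton_shift_mx m).
Proof.
apply/matrixP => i j; rewrite mul_diag_mx !mxE.
under eq_bigr do rewrite !mxE rmorphD/= rmorphMn/= rmorph_nat mulrDr.
rewrite big_split/= (bigD1 j)//= eqxx mulr1n big1 ?addr0 => [|k kj]; last first.
  by rewrite (negbTE kj) mulr0n mulr0.
rewrite (bigD1 (ordS j))//= eqxx mulr1 big1 ?addr0 => [|k kj]; last first.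
  by rewrite (negbTE kj) mulr0.
rewrite newtonS -mulrDr mulrC; congr (_ * _).
by rewrite rmorphB /t /=; ring.
Qed.

Variable d : 'rV[R]_n.
Let g := diag_mx d *m newton_mx.
Hypothesis ug : g \in unitmx.

(** Squaring makes the unit theta - a_m positive at every place, so that it acts through a positive
    diagonal matrix. *)
Definition log_unit m : 'rV[R]_n := \row_i ln (t i m ^+ 2).

Lemma log_stab_log_unit m : log_stab g (log_unit m).
Proof.
exists (newton_shift_mx m *m newton_shift_mx m).
rewrite (_ : int_mx R _ = int_mx R (newton_shift_mx m) *m int_mx R (newton_shift_mx m)); last first.
  exact: map_mxM.
have step : diag_mx (\row_i t i m) *m g = g *m int_mx R (newton_shift_mx m).
  by rewrite /g mulmxA diag_mxC -!mulmxA newton_mx_eigen.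
move: (g) step => h step; rewrite mulmxA -step -mulmxA -step mulmxA mulmx_diag.
congr (diag_mx _ *m _).
apply/rowP => i; rewrite !mxE lnK ?expr2// posrE.
by rewrite -expr2 exprn_even_gt0//= sub_theta_neq0.
Qed.

Lemma sum_log_unit : \sum_m log_unit m = 0.
Proof.
apply/rowP => i; rewrite summxE mxE; apply: expR_inj; rewrite expR0 expR_sum.
under eq_bigr => m _.
  rewrite mxE lnK; last by rewrite posrE exprn_even_gt0//= sub_theta_neq0.
  over.
by rewrite prodrXl prod_t expr1n.
Qed.

Lemma log_stab_sum (I : finType) (P : pred I) (f : I -> 'rV[R]_n) :
  (forall i, P i -> log_stab g (f i)) -> log_stab g (\sum_(i | P i) f i).
Proof.
move=> gf; elim/big_ind : _ => //; first exact: log_stab0.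
by move=> *; exact: log_stabD.
Qed.

(** The product of all the units is 1, so the inverse of one is the product of the others. *)
Lemma log_stabN_log_unit m : log_stab g (- log_unit m).
Proof.
have -> : - log_unit m = \sum_(j | j != m) log_unit j.
  by have := sum_log_unit; rewrite (bigD1 m)//= => /eqP; rewrite addr_eq0 => /eqP ->; rewrite opprK.
by apply: log_stab_sum => j _; exact: log_stab_log_unit.
Qed.

Lemma log_stabMz l (k : int) : log_stab g l -> log_stab g (- l) ->
  log_stab g (l *~ k).
Proof.
have nat m l' : log_stab g l' -> log_stab g (l' *+ m).
  move=> gl; elim: m => [|m IH]; first exact: log_stab0.
  by rewrite mulrS; exact: log_stabD.
case: k => k gl gNl; first exact: nat.
by rewrite NegzE mulrNz -mulNrz; exact: nat.
Qed.

Lemma sum_log_unit_coord m : \sum_i log_unit m 0 i = 0.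
Proof. exact: (log_stab_sum0 ug (log_stab_log_unit m) (log_stabN_log_unit m)). Qed.

(* Off-diagonal entries are positive and rows sum to zero, so the maximum
   principle leaves only constant vectors in the kernel. *)
Lemma log_unit_span (y : 'rV[R]_n) : \sum_i y 0 i = 0 ->
  exists s : 'I_n -> R, forall i, y 0 i = \sum_m s m * log_unit m 0 i.
Proof.
(* Adding the all-ones matrix makes the matrix of logarithms invertible and changes nothing on
   sum-zero vectors. *)
pose A : 'M[R]_n := \matrix_(m, i) (log_unit m 0 i + 1).
have xA (x : 'rV[R]_n) i :
    (x *m A) 0 i = \sum_m x 0 m * log_unit m 0 i + \sum_m x 0 m.
  by rewrite mxE -big_split/=; apply: eq_bigr => m _; rewrite [A m i]mxE mulrDr mulr1.
have sum_xA (x : 'rV[R]_n) : \sum_i (x *m A) 0 i = (\sum_m x 0 m) * n%:R.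
  under eq_bigr do rewrite xA.
  rewrite big_split/= sumr_const card_ord mulr_natr exchange_big/=.
  by rewrite big1 ?add0r// => m _; rewrite -mulr_sumr sum_log_unit_coord mulr0.
have n0 : n%:R != 0 :> R by rewrite pnatr_eq0 -lt0n.
have uA : A \in unitmx.
  rewrite -row_free_unit; apply: inj_row_free => x xA0.
  have sx0 : \sum_m x 0 m = 0.
    apply: (mulIf n0); rewrite -sum_xA xA0 mul0r.
    by rewrite big1// => i _; rewrite mxE.
  (* At a maximal entry [x 0 i], the terms of the sum in [xi] are all nonnegative and add up to 0,
     so each vanishes. *)
  have [i _ imax] := @arg_maxP _ _ _ (Ordinal n_gt0) xpredT (x 0) isT.
  have xi : \sum_m (x 0 i - x 0 m) * log_unit m 0 i = 0.
    under eq_bigr do rewrite mulrBl.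
    rewrite sumrB -mulr_sumr -summxE sum_log_unit mxE mulr0 sub0r.
    by have := xA x i; rewrite xA0 mxE sx0 addr0 => <-; rewrite oppr0.
  have xm m : x 0 m = x 0 i.
    have [->//|mi] := eqVneq m i.
    have tm k : k != i -> 0 < log_unit k 0 i.
      move=> ki; rewrite mxE ln_gt0// -real_normK ?num_real//.
      by rewrite exprn_egt1// (lt_le_trans c_gt1)// t_large// eq_sym.
    apply/esym/eqP; rewrite -subr_eq0.
    have /psumr_eq0P : forall k, true -> 0 <= (x 0 i - x 0 k) * log_unit k 0 i.
      move=> k _; have [->|ki] := eqVneq k i; first by rewrite subrr mul0r.
      apply: mulr_ge0; last exact/ltW/tm.
      by rewrite subr_ge0; exact: imax.
    move=> /(_ xi m isT)/eqP; rewrite mulf_eq0 => /orP[//|].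
    by rewrite (gt_eqF (tm m mi)).
  apply/rowP => m; rewrite mxE xm; move: sx0.
  under eq_bigr do rewrite xm.
  by rewrite sumr_const card_ord -mulr_natr => /eqP; rewrite mulf_eq0 (negbTE n0) orbF => /eqP.
move=> y0; exists ((y *m invmx A) 0) => i.
have yA : y *m invmx A *m A = y by rewrite mulmxKV.
have s0 : \sum_m (y *m invmx A) 0 m = 0.
  by apply: (mulIf n0); rewrite -sum_xA yA y0 mul0r.
by rewrite -{1}yA xA s0 addr0.
Qed.

(** Rounding down the real coefficients on the [log_unit m] leaves a remainder with coefficients in
    [0, 1), whence the constant. *)
Lemma eigen_log_cocompact : log_cocompact g.
Proof.
exists (\sum_i \sum_m `|log_unit m 0 i|) => y /log_unit_span[s ys].
pose l := \sum_m log_unit m *~ (- Num.floor (s m)).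
have gl : log_stab g l.
  apply: log_stab_sum => m _.
  by apply: log_stabMz; [exact: log_stab_log_unit|exact: log_stabN_log_unit].
have gNl : log_stab g (- l).
  rewrite -sumrN; apply: log_stab_sum => m _; rewrite -mulrNz.
  by apply: log_stabMz; [exact: log_stab_log_unit|exact: log_stabN_log_unit].
exists l; split=> //; first exact: log_stab_sum0 gl gNl.
move=> i; have -> : y 0 i + l 0 i = \sum_m (s m - (Num.floor (s m))%:~R) * log_unit m 0 i.
  rewrite ys summxE -big_split/=; apply: eq_bigr => m _.
  have -> (w : 'rV[R]_n) (k : int) : (w *~ k) 0 i = k%:~R * w 0 i.
    by rewrite -scaler_int mxE.
  by rewrite mulrBl rmorphN /= mulNr.
rewrite (le_trans (ler_norm_sum _ _ _))// [leRHS](bigD1 i)//=.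
rewrite ler_wpDr//; first by apply: sumr_ge0 => j _; apply: sumr_ge0.
apply: ler_sum => m _; rewrite normrM ler_piMl//.
by have := floor_itv (s m); rewrite intrD ler_norml; lra.
Qed.

End EigenLattice.

(** * Existence *)

Section NearIntegerLattice.
Variables (R : realType) (n : nat).

Lemma normr_prod_ge1 (P : pred 'I_n) (f : 'I_n -> R) :
  (forall k, P k -> 1 <= `|f k|) -> 1 <= `|\prod_(k | P k) f k|.
Proof.
by move=> f1; rewrite normr_prod; elim/big_ind : _ => // x y; exact: mulr_ege1.
Qed.

(** The polynomial vanishes at a_i. Its values [A] and [- B] at a_i + 1 and a_i - 1 have opposite
    signs and absolute value at least 1, so one of them is at least 1 and the intermediate value
    theorem applies. *)
Lemma exists_root (a : 'I_n -> R) i : (forall k, i != k -> 2 <= `|a i - a k|) ->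
  exists2 x, `|x - a i| <= 1 & \prod_k (x - a k) = 1.
Proof.
move=> sep; pose q : {poly R} := \prod_k ('X - (a k)%:P).
have qE x : q.[x] = \prod_k (x - a k).
  by rewrite horner_prod; apply: eq_bigr => k _; rewrite !hornerE.
have q0 : q.[a i] = 0 by rewrite qE (bigD1 i)//= subrr mul0r.
pose A := \prod_(k | k != i) (a i + 1 - a k).
pose B := \prod_(k | k != i) (a i - 1 - a k).
have qA : q.[a i + 1] = A.
  by rewrite qE (bigD1 i)//= addrAC subrr add0r mul1r.
have qB : q.[a i - 1] = - B.
  by rewrite qE (bigD1 i)//= addrAC subrr add0r mulN1r.
have A1 : 1 <= `|A|.
  apply: normr_prod_ge1 => k; rewrite eq_sym => /sep; rewrite !ler_normr; lra.
have B1 : 1 <= `|B|.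
  apply: normr_prod_ge1 => k; rewrite eq_sym => /sep; rewrite !ler_normr; lra.
have AB : 0 <= A * B.
  rewrite -big_split/=; apply: prodr_ge0 => k; rewrite eq_sym => /sep.
  by rewrite ler_normr => /orP[] h; nra.
have [hA|hA] := leP 1 A.
  have [||x /andP[x1 x2]] := @poly_ivt R (q - 1) (a i) (a i + 1).
  - by lra.
  - by rewrite !hornerE q0 qA; lra.
  rewrite rootE !hornerE subr_eq0 qE => /eqP xq; exists x => //.
  by rewrite ler_norml; lra.
have {}hA : A <= -1 by move: A1; rewrite ler_normr; lra.
have {}hB : B <= -1 by move: B1; rewrite ler_normr => /orP[]//; nra.
have [||x /andP[x1 x2]] := @poly_ivt R (1 - q) (a i - 1) (a i).
- by lra.
- by rewrite !hornerE q0 qB; lra.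
rewrite rootE !hornerE subr_eq0 eq_sym qE => /eqP xq; exists x => //.
by rewrite ler_norml; lra.
Qed.

(** The scaling [d] commutes with the diagonal stabilizers and is left free for normalizing the
    determinant. *)
Lemma exists_near_id (c : R) : (0 < n)%N -> 1 < c ->
  exists G : 'M[R]_n, (forall i j, `|G i j - (i == j)%:R| <= c^-1) /\
    forall d : 'rV[R]_n, diag_mx d *m G \in unitmx -> log_cocompact (diag_mx d *m G).
Proof.
move=> n0 c1; pose N := (Num.truncn c).+3.
have Nc : c + 1 <= N%:R.
  have c0 : 0 <= c by rewrite ltW// (lt_trans ltr01).
  by have /andP[_] := truncn_itv c0; rewrite /N -!natr1; lra.
pose a (k : 'I_n) : int := (N * k)%:Z.
have sep (i k : 'I_n) : i != k -> N%:R <= `|(a i)%:~R - (a k)%:~R| :> R.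
  move=> ik; rewrite -rmorphB/= -intr_norm -[N%:R]/(N%:Z%:~R) ler_int /a.
  have {}ik : (i : nat) <> k by apply/eqP.
  by rewrite !PoszM -mulrBr normrM ger0_norm// ler_peMr//; lia.
have ex i : exists x : R, `|x - (a i)%:~R| <= 1 /\ \prod_k (x - (a k)%:~R) = 1.
  have [|x x1 x2] := @exists_root (fun k => (a k)%:~R) i; last by exists x.
  by move=> k /sep; apply: le_trans; lra.
have /choice[theta th] := ex.
have prod_t i : \prod_k (theta i - (a k)%:~R) = 1 by case: (th i).
have t_large i k : i != k -> c <= `|theta i - (a k)%:~R|.
  move=> /sep; have [+ _] := th i; rewrite !ler_normr ler_norml; lra.
exists (near_id a theta); split; first exact: near_id_le.
move=> d; rewrite near_idE mulmxA mulmx_diag => ud.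
exact: (eigen_log_cocompact n0 c1).
Qed.

Lemma near_id_coor (G : 'M[R]_n) (c : R) z : (0 < n)%N -> 0 < c ->
    (forall i j, `|G i j - (i == j)%:R| <= c^-1) -> z != 0 ->
  exists i, 1 - n%:R / c <= `|coor G z i|.
Proof.
move=> n0 c0 Gc z0.
have [i _ imax] := @arg_maxP _ _ _ (Ordinal n0) xpredT (fun i => `|z i 0|) isT.
exists i; set m : R := `|(z i 0)%:~R|.
have m1 : 1 <= m.
  rewrite /m -intr_norm ler1z -gtz0_ge1 normr_gt0; apply: contra z0 => /eqP zi.
  apply/eqP/matrixP => j k; rewrite ord1 [RHS]mxE.
  by have /= := imax j isT; rewrite zi normr0 normr_le0 => /eqP.
have mE j : `|(z j 0)%:~R| <= m by rewrite /m -!intr_norm ler_int; exact: imax.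
have E : (z i 0)%:~R = coor G z i - \sum_j (G i j - (i == j)%:R) * (z j 0)%:~R.
  rewrite coorE -sumrB (bigD1 i)//= big1 ?addr0 => [|j ji].
    by rewrite eqxx mulr1n; ring.
  by rewrite eq_sym (negbTE ji) mulr0n; ring.
have : m <= `|coor G z i| + n%:R * (c^-1 * m).
  rewrite {1}/m E (le_trans (ler_normB _ _))// lerD2l.
  rewrite (le_trans (ler_norm_sum _ _ _))// mulr_natl -[X in _ *+ X]card_ord -sumr_const.
  by apply: ler_sum => j _; rewrite normrM ler_pM.
have [nc|nc] := lerP (n%:R / c) 1.
  rewrite mulrA => h; have := normr_ge0 (coor G z i).
  by have : 0 <= (1 - n%:R / c) * (m - 1); [rewrite mulr_ge0 ?subr_ge0|lra].
by move=> _; rewrite (le_trans _ (normr_ge0 _))// subr_le0 ltW.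
Qed.

End NearIntegerLattice.

Lemma exists_number_field_lattice (R : realType) (n : nat) (x : R) :
    (1 < n)%N -> x < 1 -> exists L : lattice_space R n,
  [/\ number_field_lattice L, x < kappa (lattice L), kappa (lattice L) < 1,
      is_lattice (lattice L) & ~ decomposable (lattice L)].
Proof.
move=> n1 x1; have n0 := ltnW n1.
pose c (k : nat) : R := k.+2%:R.
have c1 k : 1 < c k by rewrite /c ltr1n.
have c0 k : 0 < c k by rewrite (lt_trans ltr01).
have /choice[G GP] := fun k => exists_near_id n0 (c1 k).
have cvgc : (c k)^-1 @[k --> \oo] --> (0 : R).
  by have := @cvg_harmonic R; rewrite -cvg_shiftS.
have detG : \det (G k) @[k --> \oo] --> (1 : R).
  rewrite -(det1 R n); apply: cvg_det => i j; rewrite !mxE.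
  apply/cvgrPdist_le => e e0; near=> k; rewrite distrC.
  apply: le_trans ((GP k).1 i j) _; apply/ltW.
  by near: k; exact: cvgr_lt cvgc _ e0.
pose r k : R := 1 - n.*2%:R / c k.
have cvgr : r k @[k --> \oo] --> (1 : R).
  rewrite -[X in _ --> X]subr0; apply: cvgB; first exact: cvg_cst.
  by rewrite -[X in _ --> X](mulr0 n.*2%:R); exact: cvgMl_tmp.
have cvgv : r k ^+ n / `|\det (G k)| @[k --> \oo] --> (1 : R).
  have -> : (1 : R) = 1 ^+ n / `|1| by rewrite expr1n normr1 divr1.
  apply: cvgM; first exact: (continuous_cvg _ (@exprn_continuous R n 1) cvgr).
  by apply: cvgV; [rewrite normr1 oner_neq0|exact: cvg_norm].
near \oo => k.
have rk : 0 < r k by near: k; exact: cvgr_gt cvgr _ ltr01.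
have dGk : 0 < \det (G k) by near: k; exact: cvgr_gt detG _ ltr01.
have xk : x < r k ^+ n / `|\det (G k)| by near: k; exact: cvgr_gt cvgv _ x1.
pose i0 := Ordinal n0.
pose d : 'rV[R]_n := \row_i (if i == i0 then (\det (G k))^-1 else 1).
pose g := diag_mx d *m G k.
have detd : \prod_i d 0 i = (\det (G k))^-1.
  rewrite (bigD1 i0)//= big1 ?mulr1 => [|i i_neq]; first by rewrite mxE eqxx.
  by rewrite mxE (negbTE i_neq).
have dg : \det g = 1 by rewrite det_mulmx det_diag detd mulVf ?gt_eqF.
have ug : g \in unitmx by rewrite unitmxE dg unitr1.
have cg : log_cocompact g by exact: (GP k).2.
have [kappa_lt kappa_ge] := kappa_bounds n1 dg cg.
exists (to_lattice dg); rewrite lattice_to_lattice; split => //.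
- exact: log_cocompact_number_field.
- have d0 i : 0 < d 0 i by rewrite mxE; case: ifP => _; rewrite ?invr_gt0.
  apply: lt_le_trans (kappa_ge (fun i => d 0 i * r k) _ _).
  + rewrite big_split/= detd prodr_const card_ord mulrC.
    by rewrite -[X in _ * X^-1]gtr0_norm.
  + by move=> i; rewrite mulr_gt0.
  + move=> z z0; have [i zi] := near_id_coor n0 (c0 k) (GP k).1 z0.
    exists i; rewrite /coor -mulmxA mul_diag_mx mxE normrM gtr0_norm//.
    rewrite ltr_pM2l//; apply: lt_le_trans zi.
    by rewrite ltrD2l ltrN2 ltr_pM2r ?invr_gt0// ltr_nat -addnn -[ltnLHS]addn0 ltn_add2l.
- by exists g.
- by apply: not_decomposable => // z i; exact: log_cocompact_coor_neq0.
Unshelve. all: by end_near. Qed.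

Unset Implicit Arguments.

Theorem corollary1p15 (R : realType) (n : nat) (n_ge2 : (2 <= n)%N) :
  (exists L : nat -> lattice_space R n,
     [/\ forall k, number_field_lattice (L k),
         increasing_seq (fun k => kappa (lattice (L k))) &
         kappa (lattice (L k)) @[k --> \oo] --> (1 : R)])
  /\ (~ isolated (reduced_MG R n) 1 /\ limit_point (reduced_MG R n) 1).
Proof.
have ex (x : R) : exists L : lattice_space R n, x < 1 ->
  [/\ number_field_lattice L, x < kappa (lattice L), kappa (lattice L) < 1,
      is_lattice (lattice L) & ~ decomposable (lattice L)].
  have [x1|_] := ltP x 1.
    by have [L LP] := exists_number_field_lattice n_ge2 x1; exists L.
  have [L _] := exists_number_field_lattice n_ge2 (@ltr01 R).
  by exists L.
have /choice[F FP] := ex.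
have lim : limit_point (reduced_MG R n) 1.
  move=> U /nbhs_ballP[e /= e0 eU].
  have lt1 : 1 - e < 1 by rewrite ltrBlDr ltrDl.
  have [_ lt_k k_lt lat ndec] := FP _ lt1.
  exists (kappa (lattice (F (1 - e)))); split; first by rewrite lt_eqF.
    by exists (lattice (F (1 - e))).
  by apply: eU; rewrite /ball/= ltr_norml; lra.
split; last first.
  split=> // -[_ [V V1 VE]]; have [y [y1 Ey Vy]] := lim V V1.
  have : (V `&` reduced_MG R n) y by [].
  by rewrite VE => /= yE; rewrite yE eqxx in y1.
pose x := fix x (k : nat) : R :=
  if k is k'.+1 then Num.max (kappa (lattice (F (x k')))) (1 - k%:R^-1) else 0.
have x1 k : x k < 1.
  elim: k => [|k IH] /=; first exact: ltr01.
  rewrite gt_max ltrBlDr ltrDl invr_gt0 ltr0n andbT.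
  by have [] := FP _ IH.
have incr k : kappa (lattice (F (x k))) < kappa (lattice (F (x k.+1))).
  have [_ + _ _ _] := FP _ (x1 k.+1); apply: le_lt_trans.
  by rewrite /= le_max lexx.
exists (fun k => F (x k)); split.
- by move=> k; have [] := FP _ (x1 k).
- exact/increasing_seqP.
- apply/cvgrPdist_lt => e e0; near=> k.
  have k0 : (0 < k)%N by near: k; exact: nbhs_infty_gt.
  have [_ lt_k k_lt _ _] := FP _ (x1 k).
  rewrite gtr0_norm ?subr_gt0// ltrBlDr -ltrBlDl; apply: le_lt_trans lt_k.
  rewrite -(prednK k0) /= le_max; apply/orP; right.
  rewrite lerD2l lerN2 invf_ple ?posrE// prednK//.
  near: k; exact: nbhs_infty_ger.
Unshelve. all: by end_near. Qed.
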